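(* Every finite-dimensional real normed space $Y$ has the approximate hyperplane sum property for $\ell_\infty^4$ (AHSp-$\ell_\infty^4$).
   Context: All spaces are real. $B_Y$, $S_Y$, $Y^*$ denote the closed unit ball, unit sphere and topological dual of $Y$. $M_Y^4=\{(y_i)_{i\le 4}\in (B_Y)^4: y_{i_1}-y_{i_2}+y_{i_3}\in B_Y \text{ for all } 1\le i_1<i_2<i_3\le 4\}$. $Y$ has the AHSp-$\ell_\infty^4$ if for every $0<\varepsilon<1$ there is $0<\gamma(\varepsilon)<\varepsilon$ such that for every $(y_i)_{i\le 4}\in M_Y^4$: if there exist a nonempty $A\subset\{1,2,3,4\}$ and $y^*\in S_{Y^*}$ with $y^*(y_i)>1-\gamma(\varepsilon)$ for each $i\in A$, then there exists $(z_i)_{i\le 4}\in M_Y^4$ with $\|z_i-y_i\|<\varepsilon$ for every $i\le 4$ and $\|\sum_{i\in A}z_i\|=|A|$. *)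

(* Defs.v *)
From mathcomp Require Import all_boot all_order all_algebra.
From mathcomp Require Import all_classical all_reals all_analysis.

Set Implicit Arguments.
Unset Strict Implicit.
Unset Printing Implicit Defensive.

Import Order.TTheory GRing.Theory Num.Theory.
Import numFieldNormedType.Exports.

Local Open Scope classical_set_scope.
Local Open Scope ring_scope.

(* [Vector.axiom] lives in [Type], hence the [inhabited]. *)
Definition finite_dimensional (R : realType) (Y : normedModType R) : Prop :=
  exists n : nat, inhabited (Vector.axiom n Y).

Definition unit_ball (R : realType) (Y : normedModType R) : set Y :=
  [set y | `|y| <= 1].

(* The real-valued [sup] is the operator norm only for bounded functionals:
   it is 0 on unbounded sets, so continuity is required separately below. *)
Definition dual_norm (R : realType) (Y : normedModType R)
    (f : {linear Y -> R^o}) : R :=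
  sup [set `|f y| | y in @unit_ball R Y].

Definition dual_unit_sphere (R : realType) (Y : normedModType R) :
    set {linear Y -> R^o} :=
  [set f : {linear Y -> R^o} | continuous f /\ dual_norm f = 1].

(* The indices 1, ..., 4 are the elements of ['I_4]. *)
Definition M4 (R : realType) (Y : normedModType R) : set ('I_4 -> Y) :=
  [set y | (forall i, unit_ball (y i)) /\
    (forall i1 i2 i3 : 'I_4, (i1 < i2 < i3)%N ->
      unit_ball (y i1 - y i2 + y i3))].

Definition AHSp_linfty4 (R : realType) (Y : normedModType R) : Prop :=
  forall eps : R, 0 < eps < 1 ->
  exists2 gamma : R, 0 < gamma < eps &
  forall y : 'I_4 -> Y, M4 y ->
  forall A : {set 'I_4}, A != finset.set0 ->
  forall f : {linear Y -> R^o}, dual_unit_sphere f ->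
  (forall i, i \in A -> f (y i) > 1 - gamma) ->
  exists z : 'I_4 -> Y,
    [/\ M4 z, (forall i, `|z i - y i| < eps) &
        `|\sum_(i in A) z i| = #|A|%:R].

(* Main.v *)
(* Compactness: [M4] is compact in [Y ^ 4], so off the [eps]-neighbourhood of
   the tuples [z] with [`|\sum_(i in A) z i| = #|A|] the norm of the sum stays
   below [#|A|] by a fixed margin, whereas [f (y i) > 1 - gamma] on [A] forces
   it above [#|A| * (1 - gamma)]. *)

Require Import Defs.
From HB Require Import structures.
From mathcomp Require Import all_boot all_order all_algebra.
From mathcomp Require Import all_classical all_reals all_analysis.
From mathcomp Require Import lra.

Set Implicit Arguments.
Unset Strict Implicit.
Unset Printing Implicit Defensive.

Import Order.TTheory GRing.Theory Num.Theory.
Import numFieldNormedType.Exports.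

Local Open Scope classical_set_scope.
Local Open Scope ring_scope.

Lemma closed_norm_le (R : realType) (T : topologicalType)
    (Y : normedModType R) (g : T -> Y) (r : R) :
  continuous g -> closed [set x | `|g x| <= r].
Proof.
move=> cg; apply: (@preimage_closed _ _ (fun x => `|g x|) [set s | s <= r]).
  by move=> x _; apply: cvg_norm; exact: cg.
exact: closed_le.
Qed.

Lemma norm_normalized (R : realType) (Y : normedModType R) (y : Y) :
  y != 0 -> `| `|y|^-1 *: y | = 1.
Proof. by move=> y0; rewrite normrZ normfV normr_id mulVf ?normr_eq0. Qed.

(** [g] is a finite sum of coordinate functions multiplied by fixed vectors of [Y]. *)
Lemma linear_rV_continuous (R : realType) (Y : normedModType R) (n : nat)
    (g : {linear 'rV[R]_n -> Y}) :
  continuous g.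
Proof.
have -> : g = (fun v => \sum_(j < n) v ord0 j *: g (delta_mx ord0 j))
    :> (_ -> _).
  apply/funext => v; rewrite {1}[v]row_sum_delta linear_sum.
  by apply: eq_bigr => j _; rewrite linearZ.
apply: continuous_big => [|j _ v]; first exact: add_continuous.
apply: continuousZr_tmp.
exact: (@coord_continuous R 1 n ord0 j).
Qed.

(** Coordinates give a continuous linear bijection [g] from ['rV[R]_n]. A bound [c * |v| <= |g v|]
    with [c > 0] makes the preimage of the ball bounded; it is also closed, hence compact, and the
    ball is its image. *)
Lemma unit_ball_compact (R : realType) (Y : normedModType R) :
  finite_dimensional Y -> compact (@unit_ball R Y).
Proof.
move=> [n [[r lr [h rK hK]]]].
have lh : linear h by move=> a u v; apply: (can_inj rK); rewrite hK lr !hK.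
have [g gK {}rK] : exists2 g : {linear 'rV[R]_n -> Y}, cancel g r & cancel r g.
  pose g : {linear 'rV[R]_n -> Y} :=
    HB.pack h (GRing.isLinear.Build _ _ _ _ h lh).
  by exists g.
have cg : continuous g := @linear_rV_continuous _ _ _ g.
pose S : set 'rV[R]_n := [set v | `|v| = 1].
have cS : compact S.
  apply: bounded_closed_compact.
    by exists 1; split => // M M1 v /= ->; exact: ltW.
  apply: (@preimage_closed _ _ (fun v : 'rV[R]_n => `|v|) [set s | s = 1]).
    by move=> v _; exact: norm_continuous.
  exact: closed_eq.
(* [g] is injective, so [`|g v|] has a positive minimum on the sphere. *)
have [c c0 gc] : exists2 c : R, 0 < c & forall v, c * `|v| <= `|g v|.
  (* The sphere is empty only in dimension 0, where every [v] is 0 and any positive constant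
     works. *)
  have [S0|/set0P Sn0] := eqVneq S set0.
    exists 1 => // v; have [->|v0] := eqVneq v 0; first by rewrite normr0 mulr0.
    have : S (`|v|^-1 *: v) by exact: norm_normalized.
    by rewrite S0.
  have [u uS umin] := compact_EVT_min Sn0 cS
    (continuous_subspaceT (fun v => cvg_norm (cg v))).
  have {}uS : `|u| = 1 by move: uS; rewrite inE.
  exists `|g u| => [|v].
    rewrite normr_gt0; apply/eqP => gu0.
    have u0 : u = 0 by apply: (can_inj gK); rewrite gu0 linear0.
    by move: uS; rewrite u0 normr0 => /esym/eqP; rewrite oner_eq0.
  have [->|v0] := eqVneq v 0; first by rewrite normr0 mulr0.
  rewrite -ler_pdivlMr ?normr_gt0// mulrC.
  have -> : `|v|^-1 * `|g v| = `|g (`|v|^-1 *: v)|.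
    by rewrite linearZ normrZ normfV normr_id.
  by apply: umin; rewrite inE; exact: norm_normalized.
have -> : @unit_ball R Y = g @` [set v | `|g v| <= 1].
  apply/seteqP; split => [y y1|_ [v v1 <-]//].
  by exists (r y); rewrite /= rK.
apply: continuous_compact; first exact: continuous_subspaceT.
apply: bounded_closed_compact; last exact: closed_norm_le.
exists c^-1; split; first exact: num_real.
move=> M cM v /= gv1; apply: le_trans (ltW cM).
by rewrite -[c^-1]mul1r ler_pdivlMr// mulrC (le_trans (gc v)).
Qed.

Lemma rV_coord_continuous (R : realType) (Y : normedModType R) (n : nat)
    (i : 'I_n) :
  continuous (fun v : 'rV[Y]_n => v ord0 i).
Proof.
move=> v s /= /(nbhs_ballP (v ord0 i)) [e e0 es].
by apply/nbhs_ballP; exists e => //= w [_ vw]; exact/es/vw.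
Qed.

(** Viewed as rows, the tuples form a closed subset of a product of four compact balls. *)
Lemma M4_compact (R : realType) (Y : normedModType R) :
  finite_dimensional Y -> compact [set v : 'rV[Y]_4 | M4 (v ord0)].
Proof.
move=> /unit_ball_compact cY.
apply: subclosed_compact (rV_compact (fun=> cY)) _; last by move=> v [].
have -> : [set v : 'rV[Y]_4 | M4 (v ord0)] =
    \bigcap_(i in [set: 'I_4]) [set v : 'rV[Y]_4 | `|v ord0 i| <= 1] `&`
    \bigcap_(t in [set t : 'I_4 * 'I_4 * 'I_4 | (t.1.1 < t.1.2 < t.2)%N])
      [set v : 'rV[Y]_4 | `|v ord0 t.1.1 - v ord0 t.1.2 + v ord0 t.2| <= 1].
  apply/seteqP; split => v.
    by move=> [v1 v3]; split => [i _|t tt]; [exact: v1|exact: v3].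
  move=> [v1 v3]; split => [i|i1 i2 i3 ii]; first exact: v1.
  exact: (v3 (i1, i2, i3)).
apply: closedI.
  by apply: closed_bigI => i _; apply/closed_norm_le/rV_coord_continuous.
apply: closed_bigI => t _; apply: closed_norm_le => v.
have FF := nbhs_filter v.
by apply: cvgD; [apply: cvgB|]; exact: rV_coord_continuous.
Qed.

Lemma sum_norm_le_card (R : realType) (Y : normedModType R)
    (y : 'I_4 -> Y) (A : {set 'I_4}) :
  M4 y -> `|\sum_(i in A) y i| <= #|A|%:R.
Proof.
move=> [y1 _]; rewrite -sum1_card natr_sum.
by apply: le_trans (ler_norm_sum _ _ _) _; apply: ler_sum => i _; exact: y1.
Qed.

(** This is the compactness argument for one fixed [A]. Stating it for all small [d > 0] lets the
    finitely many sets [A] share one [d] later. *)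
Lemma near_norm_sum_attained (R : realType) (Y : normedModType R)
    (A : {set 'I_4}) (eps : R) :
  finite_dimensional Y -> 0 < eps ->
  \forall d \near 0^'+, forall y : 'I_4 -> Y, M4 y ->
    #|A|%:R * (1 - d) < `|\sum_(i in A) y i| ->
    exists z : 'I_4 -> Y, [/\ M4 z, (forall i, `|z i - y i| < eps) &
      `|\sum_(i in A) z i| = #|A|%:R].
Proof.
move=> finY eps0.
pose F (v : 'rV[Y]_4) := `|\sum_(i in A) v ord0 i|.
have cF : continuous F.
  have cS : continuous (fun v : 'rV[Y]_4 => \sum_(i in A) v ord0 i).
    apply: continuous_big => [|i _]; first exact: add_continuous.
    exact: rV_coord_continuous.
  by move=> v; exact: continuous_comp (cS v) (@norm_continuous _ _ _).
(* [U] gathers the tuples that already have a suitable [z], so only its complement in the compact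
   set needs a margin. *)
pose U := \bigcup_(z in [set z : 'I_4 -> Y |
    M4 z /\ `|\sum_(i in A) z i| = #|A|%:R])
  [set v : 'rV[Y]_4 | forall i, `|z i - v ord0 i| < eps].
have oU : open U.
  apply: bigcup_open => z _; rewrite openE => v vz.
  have vzi i : nbhs v [set w : 'rV[Y]_4 | `|z i - w ord0 i| < eps].
    apply: open_nbhs_nbhs; split; last exact: vz.
    apply: (@open_comp _ _ (fun w : 'rV[Y]_4 => w ord0 i)
      [set y | `|z i - y| < eps]).
      by move=> w _; exact: rV_coord_continuous.
    by have := @ball_open _ _ (z i) eps; rewrite -ball_normE.
  exact: filter_forall vzi.
pose K := [set v : 'rV[Y]_4 | M4 (v ord0)] `&` ~` U.
have cK : compact K.
  by apply: compact_closedI; [exact: M4_compact|exact: open_closedC].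
have [d d0 Kd] : exists2 d : R, 0 < d & forall v, K v -> F v <= #|A|%:R - d.
  have [K0|/set0P Kn0] := eqVneq K set0; first by exists 1 => // v; rewrite K0.
  have [u + umax] := compact_EVT_max Kn0 cK (continuous_subspaceT cF).
  rewrite inE => -[uM uU].
  exists (#|A|%:R - F u) => [|v Kv]; last by rewrite subKr umax// inE.
  (* If the maximum over [K] were [#|A|], the maximizer [u] would be its own approximant and lie in
     [U]. *)
  rewrite subr_gt0 lt_neqAle sum_norm_le_card// andbT; apply/eqP => Fu.
  by apply: uU; exists (u ord0) => // i; rewrite subrr normr0.
near=> e => y yM ye.
pose v : 'rV[Y]_4 := \row_i y i.
have vy : v ord0 = y by apply/funext => i; rewrite mxE.
have [[z [zM zA] zv]|vU] := pselect (U v).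
  by exists z; split => // i; rewrite -vy.
have : F v <= #|A|%:R - d by apply: Kd; split => //=; rewrite vy.
(* Outside [U] the hypothesis would give [d < #|A| * e], while [#|A| <= 4] gives
   [#|A| * e <= 4 * e < d]. *)
have ed : e < d / 4 by near: e; apply: nbhs_right_lt; lra.
have e0 : 0 < e by near: e; exact: nbhs_right_gt.
have : #|A|%:R * e <= 4 * e.
  by rewrite ler_pM2r// ler_nat -[leqRHS]card_ord max_card.
by move: ye; rewrite /F vy mulrBr mulr1; lra.
Unshelve. all: by end_near. Qed.

(* A dual norm equal to 1 cannot be the junk value 0 of an unbounded [sup]. *)
Lemma dual_unit_sphere_le (R : realType) (Y : normedModType R)
    (f : {linear Y -> R^o}) (y : Y) :
  dual_unit_sphere f -> f y <= `|y|.
Proof.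
move=> [_ f1].
have sE : has_sup [set `|f y| | y in @unit_ball R Y].
  apply: contrapT => /sup_out; rewrite -/(dual_norm f) f1.
  by move/eqP; rewrite oner_eq0.
have [->|y0] := eqVneq y 0; first by rewrite linear0 normr0.
have : `|f (`|y|^-1 *: y)| <= 1.
  rewrite -f1; apply: ub_le_sup; first exact: sE.2.
  by exists (`|y|^-1 *: y) => //; rewrite /unit_ball/= norm_normalized.
rewrite linearZ normrZ normfV normr_id mulrC ler_pdivrMr ?normr_gt0// mul1r.
exact: le_trans (ler_norm _).
Qed.

Theorem proposition4p1 (R : realType) (Y : normedModType R)
  (finY : finite_dimensional Y) : AHSp_linfty4 Y.
Proof.
move=> eps /andP[eps0 eps1].
have : \forall d \near 0^'+, (0 < d < eps) /\
    forall (A : {set 'I_4}) (y : 'I_4 -> Y), M4 y ->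
    #|A|%:R * (1 - d) < `|\sum_(i in A) y i| ->
    exists z : 'I_4 -> Y, [/\ M4 z, (forall i, `|z i - y i| < eps) &
      `|\sum_(i in A) z i| = #|A|%:R].
  near=> d; split.
    by apply/andP; split; near: d; [exact: nbhs_right_gt|exact: nbhs_right_lt].
  (* There are finitely many [A], so the neighbourhoods obtained for each can be intersected. *)
  near: d; apply: filter_forall => A.
  exact: near_norm_sum_attained.
move=> /filter_ex [gamma [gamma_eps H]]; exists gamma => //.
move=> y yM A /set0Pn[i iA] f f1 fA; apply: H => //.
apply: lt_le_trans (dual_unit_sphere_le _ f1).
rewrite linear_sum /= mulr_natl -sumr_const.
(* Summing the bounds [1 - gamma < f (y i)] stays strict because [A] contains [i]. *)
by apply: ltr_sum => //; apply/hasP; exists i; rewrite ?mem_index_enum.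
Unshelve. all: by end_near. Qed.
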